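(* Suppose $$A = (\mathbb Z/2)^\ell \times \prod_{i=\ell+1}^m \mathbb Z/n_i \quad\text{and}\quad A' = (\mathbb Z/2)^{\ell'} \times \prod_{j=\ell'+1}^{m'} \mathbb Z/n'_j,$$ where $n_i, n'_j > 2$ for $i > \ell$ and $j > \ell'$. If $f: A \to A'$ is a group isomorphism with $f(\mathcal Z(A)) = \mathcal Z(A')$, then $\ell = \ell'$ and $m = m'$; additionally, up to a permutation of the $n'_j$ (that is, of the factors $\mathbb Z/n'_j$, $j>\ell'$, of $A'$), we have $n_i = n'_i$ for all $i>\ell$, and a matrix representative of $f$, written in block form with respect to the decompositions of $A$ and $A'$ into $(\mathbb Z/2)^\ell$ and the product of the remaining factors, takes the form $$f = \begin{pmatrix} f_{11} & 0 \\ f_{21} & D \end{pmatrix},$$ where $f_{11}$ is an isomorphism and $D$ is a diagonal matrix.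
   Context: For a product $A$ of finite cyclic groups, $\mathcal Z(A)$ denotes the set of elements of $A$ having at least one coordinate equal to zero (the union of the coordinate hyperplanes). In the block matrix, $f_{11}: (\mathbb Z/2)^\ell \to (\mathbb Z/2)^\ell$, $f_{21}: (\mathbb Z/2)^\ell \to \prod_{j>\ell} \mathbb Z/n'_j$, and $D: \prod_{i>\ell}\mathbb Z/n_i \to \prod_{j>\ell} \mathbb Z/n'_j$. *)

(* Defs.v *)
From HB Require Import structures.
From mathcomp Require Import all_boot all_algebra.

Set Implicit Arguments.
Unset Strict Implicit.
Unset Printing Implicit Defensive.

Import GRing.Theory.
Local Open Scope ring_scope.

(* MathComp has no additive-group instance on dependent finite functions, so
   the product of the Z/n_i gets its own name and the pointwise structure.
   'Z_(n i) is Z/n_i only if n i > 1; this definition is meant for n i > 2. *)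
Definition Zprod (k : nat) (n : 'I_k -> nat) : predArgType :=
  {dffun forall i : 'I_k, 'Z_(n i)}.

HB.instance Definition _ (k : nat) (n : 'I_k -> nat) :=
  Finite.copy (Zprod n) {dffun forall i : 'I_k, 'Z_(n i)}.

Section ZprodZmodule.
Variables (k : nat) (n : 'I_k -> nat).
Implicit Types x y z : Zprod n.

Definition Zprod_zero : Zprod n := [ffun i : 'I_k => (0 : 'Z_(n i))].
Definition Zprod_opp x : Zprod n := [ffun i : 'I_k => (- x i : 'Z_(n i))].
Definition Zprod_add x y : Zprod n :=
  [ffun i : 'I_k => (x i + y i : 'Z_(n i))].

Fact Zprod_addA : associative Zprod_add.
Proof. by move=> x y z; apply/ffunP=> i; rewrite !ffunE addrA. Qed.

Fact Zprod_addC : commutative Zprod_add.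
Proof. by move=> x y; apply/ffunP=> i; rewrite !ffunE addrC. Qed.

Fact Zprod_add0 : left_id Zprod_zero Zprod_add.
Proof. by move=> x; apply/ffunP=> i; rewrite !ffunE add0r. Qed.

Fact Zprod_addN : left_inverse Zprod_zero Zprod_opp Zprod_add.
Proof. by move=> x; apply/ffunP=> i; rewrite !ffunE addNr. Qed.

HB.instance Definition _ :=
  GRing.isZmodule.Build (Zprod n) Zprod_addA Zprod_addC Zprod_add0 Zprod_addN.

End ZprodZmodule.

Notation cycprod l n := ('cV['Z_2]_l * Zprod n)%type.

(* Z(A): the union of the coordinate hyperplanes. *)
Definition zeroset (l k : nat) (n : 'I_k -> nat) : {set cycprod l n} :=
  [set x : cycprod l n |
    [exists i : 'I_l, x.1 i ord0 == 0] || [exists i : 'I_k, x.2 i == 0]].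

Definition red (l k : nat) (n : 'I_k -> nat) (z : 'cV[int]_(l + k)) :
    cycprod l n :=
  (\col_i (z (lshift k i) ord0)%:~R,
   [ffun i : 'I_k => ((z (rshift l i) ord0)%:~R : 'Z_(n i))]).

(* An integer matrix represents f when it lifts f through the reductions;
   its j-th column then reduces to the image of the j-th standard generator. *)
Definition represents (l k l' k' : nat) (n : 'I_k -> nat) (n' : 'I_k' -> nat)
    (M : 'M[int]_(l' + k', l + k)) (f : cycprod l n -> cycprod l' n') : Prop :=
  forall z : 'cV[int]_(l + k), f (red n z) = red n' (M *m z).

Definition permute_factors (l k k' : nat) (n : 'I_k' -> nat)
    (s : 'I_k -> 'I_k') (x : cycprod l n) : cycprod l (n \o s) :=
  (x.1, [ffun i : 'I_k => (x.2 (s i) : 'Z_((n \o s) i))]).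

Definition mod2map (l l' : nat) (M : 'M[int]_(l', l)) (x : 'cV['Z_2]_l) :
    'cV['Z_2]_l' := map_mx intr M *m x.

(* Main.v *)
Require Import Defs.
From HB Require Import structures.
From mathcomp Require Import all_boot all_algebra.

Set Implicit Arguments.
Unset Strict Implicit.
Unset Printing Implicit Defensive.

Import GRing.Theory.
Local Open Scope ring_scope.

(** Let U be the complement of Z(A). The isomorphism f carries U onto U', hence
    preserves the autocorrelation G(h) = #{x in U | x - h in U}. Choosing each
    coordinate of x outside {0, h_i} factors G as a product over coordinates:
    a factor Z/p contributes p - 1 if h_i = 0 and p - 2 otherwise
    ([autocorrE]).

    A factor Z/2 with h_i <> 0 contributes 0, every other contribution is
    positive. So G(h) > 0 exactly when h lies in the subgroup B, the product of
    the factors of order > 2; f therefore maps B onto B', which is the zero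
    block of the matrix, and induces an isomorphism (Z/2)^l = A/B -> A'/B',
    which is f11 ([iso_fst_eq0], [leq_rank2]).

    On B all contributions are positive, and comparing G(x) G(y) with
    G(0) G(x + y) coordinate by coordinate gives an inequality that is strict
    at each coordinate where both x and y are nonzero. Hence disjointness of
    supports is expressed by G and +, and f preserves it on B
    ([disj_autocorr], [iso_disj]). An element supported on a single coordinate
    is never the sum of two nonzero elements with disjoint supports, so f sends
    each standard generator of B to an element supported on a single coordinate
    ([axis_image_uniq]). This defines the permutation s of the factors: it is
    injective because distinct generators have disjoint supports, and bijective
    by symmetry between f and its inverse. Comparing orders of generators gives
    n_i | n'_(s i), and the inverse gives the converse divisibility
    ([axis_image_dvd], [axis_image_inv]). The matrix of f is read off the
    images of the generators. *)

(** * Counting elements that avoid two values in each coordinate *)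

(** When the F i are positive, a strict inequality in one factor survives in the
    product, so equality of the products forces equality factor by factor. *)
Lemma eq_prodn (I : finType) (F G : I -> nat) :
    (forall i, 0 < F i)%N -> (forall i, F i <= G i)%N ->
  (\prod_i F i == \prod_i G i)%N = [forall i, F i == G i].
Proof.
move=> F_gt0 leFG; apply/eqP/forallP => [eqFG i | eqFG]; last first.
  by apply: eq_bigr => i _; apply/eqP.
rewrite eqn_leq leFG /= leqNgt; apply/negP => ltFG.
have: (\prod_j F j < \prod_j G j)%N; last by rewrite eqFG ltnn.
rewrite (bigD1 i) //= [ltnRHS](bigD1 i) //=.
apply: (@leq_trans (G i * \prod_(j | j != i) F j)).
  by rewrite ltn_pmul2r // prodn_gt0.
by rewrite leq_mul2l leq_prod ?orbT // => j _.
Qed.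

Lemma avoiding_gt0 p (a : 'Z_p) : (2 < p)%N -> (0 < p - (a != 0%R).+1)%N.
Proof.
by move=> p_gt2; rewrite subn_gt0 (leq_ltn_trans _ p_gt2) // ltnS leq_b1.
Qed.

(** [c z] counts the elements of Z/p other than 0 and z. If a and b are both
    nonzero then c a * c b = (p - 2)^2 < (p - 1) * (p - 2), whether or not a + b
    vanishes; otherwise both sides agree. This is the one-coordinate case of
    [disj_autocorr]. *)
Lemma avoiding_leqif p (a b : 'Z_p) (c := fun z : 'Z_p => (p - (z != 0%R).+1)%N) :
    (2 < p)%N ->
  (c a * c b <= c 0%R * c (a + b)%R ?= iff (a == 0%R) || (b == 0%R))%N.
Proof.
case: p a b @c => [|[|[|m]]] // a b /= _.
have [->|aN0] := eqVneq a 0; first by rewrite add0r; split; rewrite ?eqxx.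
have [->|bN0] := eqVneq b 0.
  by rewrite addr0 (negbTE aN0) mulnC; split; rewrite ?eqxx.
rewrite !subSS !subn0.
have lt_c : (m.+1 * m.+1 < m.+2 * (m.+2 - ((a + b)%R != 0%R)))%N.
  apply: (@leq_trans (m.+2 * m.+1)); first by rewrite ltn_pmul2r.
  exact: leq_mul (leqnn _) (leq_sub2l m.+2 (leq_b1 _)).
split; first exact: ltnW.
exact: ltn_eqF.
Qed.

(** * Autocorrelation of the complement of the hyperplanes *)

Section Product.
Variables (l k : nat) (n : 'I_k -> nat).
Hypothesis n_gt2 : forall i, (2 < n i)%N.
Implicit Types (h : cycprod l n) (x y : Zprod n) (i j : 'I_k).

Lemma Zprod0E i : (0 : Zprod n) i = 0.
Proof. by rewrite ffunE. Qed.

Lemma ZprodDE x y i : (x + y) i = x i + y i.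
Proof. by rewrite ffunE. Qed.

Lemma ZprodBE x y i : (x - y) i = x i - y i.
Proof. by rewrite !ffunE. Qed.

Lemma ZprodMnE x N i : (x *+ N) i = x i *+ N.
Proof. by elim: N => [|N IH]; rewrite ?Zprod0E // !mulrS ZprodDE IH. Qed.

Lemma pair0D x y : (0, x) + (0, y) = (0, x + y) :> cycprod l n.
Proof. by congr pair; rewrite addr0. Qed.

Definition axis i : Zprod n := [ffun j => (j == i)%:R : 'Z_(n j)].

Lemma axis_coord i j : axis i j = (j == i)%:R.
Proof. by rewrite ffunE. Qed.

Lemma axis_mulrn_eq0 i N : (axis i *+ N == 0) = (n i %| N)%N.
Proof.
have n_gt1 : (1 < n i)%N by apply: ltnW.
apply/eqP/idP => [/(congr1 (fun x : Zprod n => nat_of_ord (x i)))|/dvdnP[q ->]].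
  by rewrite ZprodMnE Zprod0E axis_coord eqxx val_Zp_nat //= /dvdn => ->.
apply/ffunP => j; rewrite ZprodMnE Zprod0E axis_coord.
case: eqVneq => [->|_]; last by rewrite mul0rn.
by apply: ord_inj; rewrite val_Zp_nat //= modnMl.
Qed.

Definition autocorr h : nat :=
  #|[set x : cycprod l n | (x \notin zeroset l n) && (x - h \notin zeroset l n)]|.

(** The admissible coordinates of x are chosen independently. In Z/2 the
    conditions a <> 0 and a - b <> 0 force a = 1 and b = 0, so the coordinates
    of order 2 contribute one choice if h.1 = 0 and none otherwise. *)
Lemma autocorrE h :
  autocorr h = ((h.1 == 0%R) * \prod_i (n i - (h.2 i != 0%R).+1))%N.
Proof.
pose U1 := [set x : 'cV['Z_2]_l |
  [forall i, (x i ord0 != 0) && (x i ord0 - h.1 i ord0 != 0)]].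
pose U2 i := ~: [set 0; h.2 i].
have U1E : #|U1| = (h.1 == 0).
  have Z2P (a b : 'Z_2) : (a != 0) && (a - b != 0) = (a == 1) && (b == 0).
    by case: a b => [[|[|[]]]] // ? [[|[|[]]]].
  case: eqVneq => [h0 | hN0]; last first.
    apply: eq_card0 => x; rewrite inE; apply/negbTE/negP => /forallP xU.
    case/eqP: hN0; apply/colP => i; rewrite mxE.
    by have := xU i; rewrite Z2P => /andP[_ /eqP].
  apply: etrans (cards1 (const_mx 1 : 'cV['Z_2]_l)); apply: eq_card => x.
  rewrite !inE; apply/forallP/eqP => [xU|-> i]; last by rewrite Z2P h0 !mxE !eqxx.
  by apply/colP => i; have := xU i; rewrite Z2P mxE => /andP[/eqP].
have -> : autocorr h = #|setX U1 (setXn U2)|.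
  apply: eq_card => -[x1 x2]; rewrite !inE /= !negb_or !negb_exists -!andbA.
  apply/and4P/andP => [[/forallP x1P /forallP x2P /forallP y1P /forallP y2P]|].
    split; first by apply/forallP => i; have := y1P i; rewrite !mxE x1P.
    apply/forallP => i; rewrite !inE negb_or x2P.
    by have := y2P i; rewrite ZprodBE subr_eq0.
  case=> /forallP x1P /forallP x2P; split; apply/forallP => i.
  - by case/andP: (x1P i).
  - by have := x2P i; rewrite !inE negb_or => /andP[].
  - by have /andP[_] := x1P i; rewrite !mxE.
  - by have := x2P i; rewrite !inE negb_or ZprodBE subr_eq0 => /andP[].
rewrite cardsX U1E cardsXn; congr (_ * _)%N; apply: eq_bigr => i _.
rewrite cardsCs setCK cards2 [0 == _]eq_sym; congr (_ - _)%N.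
by rewrite card_ord Zp_cast // ltnW.
Qed.

(** Factors of order > 2 have an element outside {0, h_i}, so the coordinates of
    order 2 alone decide whether the autocorrelation vanishes. *)
Lemma autocorr_gt0 h : (0 < autocorr h)%N = (h.1 == 0).
Proof.
by rewrite autocorrE muln_gt0 lt0b prodn_gt0 ?andbT // => i; apply: avoiding_gt0.
Qed.

Definition disj x y := [forall i, (x i == 0) || (y i == 0)].

(** Disjointness of supports is expressed by autocorrelations and addition
    alone, hence is invariant under isomorphisms preserving the former. *)
Lemma disj_autocorr x y :
  disj x y =
    (autocorr (0%R, x) * autocorr (0%R, y)
       == autocorr 0%R * autocorr (0, x + y)%R)%N.
Proof.
have leif i := @avoiding_leqif (n i) (x i) (y i) (n_gt2 i).
rewrite !autocorrE /= eqxx !mul1n -!big_split /= eq_prodn.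
- by apply: eq_forallb => i; rewrite Zprod0E ZprodDE (leif i).
- by move=> i; rewrite muln_gt0 !avoiding_gt0.
by move=> i; rewrite Zprod0E ZprodDE (leif i).
Qed.

(** Off coordinate i the two summands are opposite and one of them vanishes, so
    both do; at i one of them vanishes too, and that one is zero. *)
Lemma disj_add_axis x y i : disj x y -> x + y = axis i -> x = 0 \/ y = 0.
Proof.
wlog xi0 : x y / x i = 0 => [IH dxy xyi | /forallP dxy xyi].
  have /orP[/eqP xi0|/eqP yi0] := forallP dxy i; first exact: IH.
  have [||y0|x0] := IH y x yi0; [|by rewrite addrC|by right|by left].
  by apply/forallP => j; rewrite orbC (forallP dxy).
left; apply/ffunP => j; rewrite Zprod0E.
have [->//|jNi] := eqVneq j i.
have /orP[/eqP//|/eqP yj0] := dxy j.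
by have := congr1 (fun z : Zprod n => z j) xyi;
  rewrite ZprodDE yj0 addr0 axis_coord (negbTE jNi).
Qed.

End Product.

(** * Isomorphisms preserving the union of the hyperplanes *)

Section Isomorphism.
Variables (l k l' k' : nat) (n : 'I_k -> nat) (n' : 'I_k' -> nat).
Hypotheses (n_gt2 : forall i, (2 < n i)%N) (n'_gt2 : forall j, (2 < n' j)%N).
Variables (f : {additive cycprod l n -> cycprod l' n'})
          (g : {additive cycprod l' n' -> cycprod l n}).
Hypotheses (fK : cancel f g) (gK : cancel g f).
Hypothesis f_zero : forall x, (f x \in zeroset l' n') = (x \in zeroset l n).

Lemma iso_autocorr h : autocorr (f h) = autocorr h.
Proof.
have f_bij : bijective f by exists g.
rewrite /autocorr -(on_card_preimset (onW_bij _ f_bij)).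
by apply: eq_card => x; rewrite in_set in_set [RHS]in_set -raddfB !f_zero.
Qed.

(** The subgroup B = {h | h.1 = 0} is where the autocorrelation is positive. *)
Lemma iso_fst_eq0 h : ((f h).1 == 0) = (h.1 == 0).
Proof. by rewrite -!autocorr_gt0 // iso_autocorr. Qed.

Lemma isoE0 y : f (0, y) = (0, (f (0, y)).2).
Proof.
apply: injective_projections => //=.
by apply/eqP; rewrite iso_fst_eq0.
Qed.

Lemma iso_disj x y : disj (f (0, x)).2 (f (0, y)).2 = disj x y.
Proof.
rewrite (@disj_autocorr l' _ _ n'_gt2) (@disj_autocorr l _ _ n_gt2) -!isoE0 !iso_autocorr.
have -> : (0, (f (0, x)).2 + (f (0, y)).2) = f (0, x + y) :> cycprod l' n'.
  by rewrite -!pair0D -!isoE0 raddfD.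
by rewrite -(raddf0 f) !iso_autocorr.
Qed.

(** f induces an injection of A / B = (Z/2)^l into A' / B' = (Z/2)^l'. *)
Lemma leq_rank2 : (l <= l')%N.
Proof.
have inj_f1 : injective (fun x : 'cV['Z_2]_l => (f (x, 0)).1).
  move=> x y /eqP; rewrite -subr_eq0 -[_ - _]/((f (x, 0) - f (y, 0)).1).
  by rewrite -raddfB iso_fst_eq0 subr_eq0 => /eqP.
have := leq_card _ inj_f1.
by rewrite !card_mx !muln1 card_ord leq_exp2l.
Qed.

End Isomorphism.

(** * Images of the generators of the factors of order greater than 2 *)

Section Axes.
Variables (l k l' k' : nat) (n : 'I_k -> nat) (n' : 'I_k' -> nat).
Hypotheses (n_gt2 : forall i, (2 < n i)%N) (n'_gt2 : forall j, (2 < n' j)%N).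
Variables (f : {additive cycprod l n -> cycprod l' n'})
          (g : {additive cycprod l' n' -> cycprod l n}).
Hypotheses (fK : cancel f g) (gK : cancel g f).
Hypothesis f_zero : forall x, (f x \in zeroset l' n') = (x \in zeroset l n).

Let fB y := (f (0, y)).2.

Let g_zero x : (g x \in zeroset l n) = (x \in zeroset l' n').
Proof. by rewrite -f_zero gK. Qed.

Lemma axis_image_neq0 i : exists j, fB (axis n i) j != 0.
Proof.
apply/existsP; apply: contraT; rewrite negb_exists => /forallP fB0.
have /(congr1 g) : f (0, axis n i) = 0.
  rewrite (isoE0 n_gt2 n'_gt2 fK gK f_zero); congr pair.
  by apply/ffunP => j; rewrite Zprod0E; apply/eqP/negPn/fB0.
rewrite fK raddf0 => -[] /(congr1 (fun x : Zprod n => x i)).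
by rewrite axis_coord Zprod0E eqxx => /eqP; rewrite oner_eq0.
Qed.

(** If the image h of a generator were nonzero at both j and j', cutting h into
    its j-th coordinate and the rest would write it as a sum of two nonzero
    elements with disjoint supports. Their preimages would then contradict
    [disj_add_axis]. *)
Lemma axis_image_uniq i j j' :
  fB (axis n i) j != 0 -> fB (axis n i) j' != 0 -> j' = j.
Proof.
move=> hj hj'; apply/eqP/negPn/negP => j'Nj.
pose a : Zprod n' := [ffun t => if t == j then fB (axis n i) t else 0].
pose b : Zprod n' := fB (axis n i) - a.
have dab : disj a b.
  apply/forallP => t; rewrite ZprodBE ffunE.
  by case: (t == j); rewrite ?eqxx // subrr eqxx orbT.
have sum_ab : (g (0, a)).2 + (g (0, b)).2 = axis n i.
  rewrite -[_ + _]/((g (0, a) + g (0, b)).2) -raddfD pair0D.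
  by rewrite [a + _]addrC subrK -(isoE0 n_gt2 n'_gt2 fK gK f_zero) fK.
have g_inj0 c : (g (0, c)).2 = 0 -> c = 0.
  move=> gc0; have /(congr1 f) : g (0, c) = 0.
    by rewrite (isoE0 n'_gt2 n_gt2 gK fK g_zero) gc0.
  by rewrite gK raddf0 => -[].
have dgab : disj (g (0, a)).2 (g (0, b)).2.
  by rewrite (iso_disj n'_gt2 n_gt2 gK fK g_zero).
have [/g_inj0 a0|/g_inj0 b0] := disj_add_axis dgab sum_ab.
  have := congr1 (fun z : Zprod n' => z j) a0.
  by rewrite ffunE eqxx Zprod0E => /eqP; apply/negP.
have := congr1 (fun z : Zprod n' => z j') b0.
by rewrite ZprodBE ffunE (negbTE j'Nj) subr0 Zprod0E => /eqP; apply/negP.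
Qed.

(** The image of the i-th generator lies in the factor Z/n'_j, so n'_j kills it,
    and by injectivity n'_j kills the generator, whose order is n_i. *)
Lemma axis_image_dvd i j : fB (axis n i) j != 0 -> (n i %| n' j)%N.
Proof.
move=> hj; rewrite -axis_mulrn_eq0 //.
have fN0 : fB (axis n i) *+ n' j = 0.
  apply/ffunP => t; rewrite ZprodMnE Zprod0E.
  have [->|] := eqVneq (fB (axis n i) t) 0; first by rewrite mul0rn.
  move=> /(axis_image_uniq hj) ->.
  rewrite -mulr_natr; apply/eqP; rewrite (_ : (n' j)%:R = 0) ?mulr0 //.
  by apply: ord_inj; rewrite val_Zp_nat ?modnn // ltnW.
have snd_mulrn N (h : cycprod l' n') : (h *+ N).2 = h.2 *+ N :> Zprod n'.
  by elim: N => // N IH; rewrite !mulrS -IH.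
have fst_mulrn (y : Zprod n) N : ((0, y) : cycprod l n) *+ N = (0, y *+ N).
  by elim: N => // N IH; rewrite !mulrS IH pair0D.
have /(congr1 g) : f (0, axis n i *+ n' j) = 0.
  rewrite (isoE0 n_gt2 n'_gt2 fK gK f_zero); congr pair.
  by rewrite -fst_mulrn raddfMn snd_mulrn.
by rewrite fK raddf0 => -[] ->.
Qed.

Lemma axis_image_inj i i' j :
  fB (axis n i) j != 0 -> fB (axis n i') j != 0 -> i = i'.
Proof.
move=> hi hi'; apply/eqP/negPn/negP => iNi'.
have : disj (axis n i) (axis n i').
  apply/forallP => t; rewrite !axis_coord.
  by case: (eqVneq t i) => [->|_]; rewrite ?(negbTE iNi') eqxx ?orbT.
rewrite -(iso_disj n_gt2 n'_gt2 fK gK f_zero) => /forallP/(_ j).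
by rewrite (negbTE hi) (negbTE hi').
Qed.

(** The j-th generator of A' overlaps the image of the i-th generator of A;
    overlap is preserved by g, so the permutations attached to f and to g are
    inverse to each other. *)
Lemma axis_image_inv i j : fB (axis n i) j != 0 -> (g (0, axis n' j)).2 i != 0.
Proof.
move=> hj; have : ~~ disj (fB (axis n i)) (axis n' j).
  apply/negP => /forallP/(_ j).
  by rewrite (negbTE hj) axis_coord eqxx oner_eq0.
rewrite -(iso_disj n'_gt2 n_gt2 gK fK g_zero) -(isoE0 n_gt2 n'_gt2 fK gK f_zero) fK.
case/forallPn => t; rewrite axis_coord negb_or.
by case: (eqVneq t i) => [->|_]; rewrite ?eqxx // => /andP[].
Qed.

End Axes.

(** * Integer matrices representing additive maps *)

Section Representation.
Variables (l k : nat) (n : 'I_k -> nat).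

Fact red_is_zmod_morphism : zmod_morphism (@red l k n).
Proof.
move=> z w; apply: injective_projections => /=.
  by apply/colP => i; rewrite !mxE intrB.
by apply/ffunP => i; rewrite ZprodBE !ffunE !mxE intrB.
Qed.

HB.instance Definition _ :=
  GRing.isZmodMorphism.Build _ _ (@red l k n) red_is_zmod_morphism.

Definition lift_red (x : cycprod l n) : 'cV[int]_(l + k) :=
  col_mx (\col_i (x.1 i ord0 : nat)%:Z) (\col_i (x.2 i : nat)%:Z).

Lemma lift_redK : cancel lift_red (@red l k n).
Proof.
move=> [x y]; apply: injective_projections => /=.
  by apply/colP => i; rewrite mxE col_mxEu mxE -pmulrn natr_Zp.
by apply/ffunP => i; rewrite ffunE col_mxEd mxE -pmulrn natr_Zp.
Qed.

Lemma red_delta_rshift i : red n (delta_mx (rshift l i) ord0) = (0, axis n i).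
Proof.
apply: injective_projections => /=.
  by apply/colP => j; rewrite !mxE eq_lrshift.
by apply/ffunP => j; rewrite !ffunE mxE eq_rshift eqxx andbT; case: eqP.
Qed.

End Representation.

Section Matrices.
Variables (l k l' k' : nat) (n : 'I_k -> nat) (n' : 'I_k' -> nat).

Definition matrix_of (f : cycprod l n -> cycprod l' n') :
    'M[int]_(l' + k', l + k) :=
  \matrix_(i, j) lift_red (f (red n (delta_mx j ord0))) i ord0.

Lemma matrix_of_ur f i j :
  ursubmx (matrix_of f) i j = ((f (0, axis n j)).1 i ord0 : nat)%:Z.
Proof.
by rewrite ursubmxEsub mxE [LHS]mxE red_delta_rshift col_mxEu mxE.
Qed.

Lemma matrix_of_dr f i j :
  drsubmx (matrix_of f) i j = ((f (0, axis n j)).2 i : nat)%:Z.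
Proof.
by rewrite drsubmxEsub mxE [LHS]mxE red_delta_rshift col_mxEd mxE.
Qed.

(** Both sides are additive in the integer vector, so it suffices to compare them
    on the standard basis, where the column was chosen to be a lift. *)
Lemma matrix_ofP (f : {additive cycprod l n -> cycprod l' n'}) :
  represents (matrix_of f) f.
Proof.
move=> z; rewrite [z]matrix_sum_delta mulmx_sumr !raddf_sum /=.
apply: eq_bigr => i _; rewrite big_ord1.
rewrite -scalemxAr -[z i _]intz !scaler_int !raddfMz /= -colE.
congr (_ *~ _); rewrite -[LHS]lift_redK; congr red.
by apply/colP => t; rewrite !mxE.
Qed.

(** Because the upper right block vanishes, f11 computes the (Z/2)-part of f
    whatever the other coordinates y are. *)
Lemma represents_fst (f : cycprod l n -> cycprod l' n') f11 f21 D x y :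
  represents (block_mx f11 0 f21 D) f -> (f (x, y)).1 = mod2map f11 x.
Proof.
move/(_ (lift_red (x, y))); rewrite lift_redK mul_block_col mul0mx addr0 => ->.
apply/colP => i; rewrite mxE col_mxEu /mod2map.
rewrite -[in RHS](_ : map_mx intr (\col_i (x i ord0 : nat)%:Z) = x).
  by rewrite -map_mxM !mxE.
by apply/colP => t; rewrite !mxE -pmulrn natr_Zp.
Qed.

Fact permute_factors_is_zmod_morphism (s : 'I_k -> 'I_k') :
  zmod_morphism (@permute_factors l k k' n' s).
Proof.
move=> x y; apply: injective_projections => //=.
by apply/ffunP => i; rewrite ZprodBE !ffunE.
Qed.

HB.instance Definition _ (s : 'I_k -> 'I_k') :=
  GRing.isZmodMorphism.Build _ _ (@permute_factors l k k' n' s)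
    (permute_factors_is_zmod_morphism s).

End Matrices.

Theorem theorem2 (l m l' m' : nat) (hlm : (l <= m)%N) (hlm' : (l' <= m')%N)
    (n : 'I_(m - l) -> nat) (n' : 'I_(m' - l') -> nat)
    (hn : forall i, (2 < n i)%N) (hn' : forall j, (2 < n' j)%N)
    (f : {additive cycprod l n -> cycprod l' n'}) (f_iso : bijective f)
    (f_zero : f @: zeroset l n = zeroset l' n') :
  [/\ l = l', m = m' &
    exists s : 'I_(m - l) -> 'I_(m' - l'),
      [/\ bijective s,
          forall i, n i = n' (s i) &
          exists (f11 : 'M[int]_(l', l)) (f21 : 'M[int]_(m - l, l))
                 (D : 'M[int]_(m - l)),
            [/\ represents (block_mx f11 0 f21 D)
                  (fun x => permute_factors s (f x)),
                bijective (mod2map f11) &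
                is_diag_mx D]]].
Proof.
case: f_iso => g0 fK gK.
have g0_add : zmod_morphism g0 := can2_zmod_morphism fK gK.
pose gM := GRing.isZmodMorphism.Build _ _ g0 g0_add.
pose g : {additive cycprod l' n' -> cycprod l n} := HB.pack g0 gM.
have fZ x : (f x \in zeroset l' n') = (x \in zeroset l n).
  by rewrite -f_zero mem_imset //; apply: can_inj fK.
have gZ x : (g x \in zeroset l n) = (x \in zeroset l' n') by rewrite -fZ gK.
have eq_l : l = l'.
  apply/eqP; rewrite eqn_leq (leq_rank2 hn hn' (f := f) (g := g)) //.
  by rewrite (leq_rank2 hn' hn (f := g) (g := f)).
have [s sP] := fin_all_exists (axis_image_neq0 hn hn' (f := f) (g := g) fK gK fZ).
have [t tP] := fin_all_exists (axis_image_neq0 hn' hn (f := g) (g := f) gK fK gZ).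
have s_inj : injective s.
  move=> i i' eq_s; apply: (axis_image_inj hn hn' (f := f) (g := g) fK gK fZ (sP i)).
  by rewrite eq_s.
have t_inj : injective t.
  move=> i i' eq_t; apply: (axis_image_inj hn' hn (f := g) (g := f) gK fK gZ (tP i)).
  by rewrite eq_t.
have eq_k : (m - l = m' - l')%N.
  apply/eqP; rewrite eqn_leq.
  by have := leq_card _ s_inj; have := leq_card _ t_inj; rewrite !card_ord => -> ->.
split=> //; first by rewrite -(subnK hlm) -(subnK hlm') eq_k eq_l.
exists s; split.
- by apply: inj_card_bij => //; rewrite !card_ord eq_k.
- move=> i; apply/eqP; rewrite eqn_dvd (axis_image_dvd hn hn' (f := f) (g := g)) //=.
  apply: (axis_image_dvd hn' hn (f := g) (g := f)) => //.
  exact: (axis_image_inv hn hn' (f := f) (g := g)).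
(* Composing with the permutation puts the image of the i-th generator in
   position i. *)
pose F : {additive cycprod l n -> cycprod l' (n' \o s)} := permute_factors s \o f.
pose M := matrix_of F; exists (ulsubmx M), (dlsubmx M), (drsubmx M).
have M_upper : ursubmx M = 0.
  apply/matrixP => i j; rewrite matrix_of_ur [RHS]mxE /=.
  by rewrite (isoE0 hn hn' (f := f) (g := g)) //= mxE.
have M_rep : represents (block_mx (ulsubmx M) 0 (dlsubmx M) (drsubmx M)) F.
  by rewrite -M_upper submxK; apply: matrix_ofP.
split=> //; last first.
  apply/is_diag_mxP => i j iNj; rewrite matrix_of_dr ffunE.
  apply/eqP; rewrite eqz_nat; apply: contraNT iNj => fN0.
  have /s_inj -> // : s i = s j.
  apply: (axis_image_uniq hn hn' (f := f) (g := g) fK gK fZ (sP j)).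
  by apply: contraNneq fN0 => ->.
apply: inj_card_bij; last by rewrite !card_mx eq_l.
move=> x y; rewrite -!(represents_fst _ 0 M_rep) /= => /eqP.
rewrite -subr_eq0 -[_ - _]/((f (x, 0) - f (y, 0)).1) -raddfB.
by rewrite (iso_fst_eq0 hn hn' (f := f) (g := g)) // subr_eq0 => /eqP.
Qed.
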